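(* Let $\Gamma$ be a finite connected graph without loops, with a Hamiltonian $\mathcal H$ and associated Lagrangian $\mathcal L$. For every $c\in H^1(\Gamma,\mathbb R)$, $$\widetilde{\mathcal M}_c=\{(e,\mathcal Q_c(e)) : e\in\mathcal M_c\},$$ where $\mathcal M_c=\pi_E(\widetilde{\mathcal M}_c)\subseteq \mathcal A_c$ is the projected Mather set.
   Context: Graph. $\Gamma=(V,E)$ consists of disjoint finite sets $V$ (vertices) and $E\neq\emptyset$ (directed edges), a map $o:E\to V$ (origin) and a fixed-point-free involution $e\mapsto -e$ of $E$; $t(e):=o(-e)$. A path is a finite sequence of edges $(e_i)_{i=1}^M$ with $t(e_i)=o(e_{i+1})$; it is closed (a cycle) if $o(e_1)=t(e_M)$. $\Gamma$ is connected (any two vertices are linked by a path) and has no loops ($o(e)\ne t(e)$). (Co)homology. $C_0$ is the real vector space with basis $V$; $C_1$ is the real vector space generated by $E$ with the edge $-e$ identified with the opposite of $e$; $\partial e=t(e)-o(e)$; $H_1(\Gamma,\mathbb R)=\ker\partial\subset C_1$. $C^0$ = functions $V\to\mathbb R$; $C^1$ = functions $\omega:E\to\mathbb R$ with $\omega(-e)=-\omega(e)$; $dg(e)=g(t(e))-g(o(e))$; $H^1(\Gamma,\mathbb R)=C^1/dC^0$. The pairing $\langle\omega,e\rangle=\omega(e)$ extends linearly to $C^1\times C_1$ and descends to $H^1\times H_1$. Tangent bundle and measures. $T\Gamma=(E\times[0,+\infty))/\sim$, where $(e,0)\sim(-e,0)$; $\mathbb R^+_e:=\{e\}\times[0,+\infty)$.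 The metric is $d((e_1,q_1),(e_2,q_2))=q_1+q_2+1$ if $e_1\ne\pm e_2$, $|q_1-q_2|$ if $e_1=e_2$, $q_1+q_2$ if $e_1=-e_2$. $\mathbb P$ is the set of Borel probability measures on $T\Gamma$ with $\int q\,d\mu<+\infty$. For $\mu\in\mathbb P$, $\rho(\mu)=\sum_{e\in E}\big(\int_{\mathbb R^+_e}q\,d\mu\big)e\in C_1$ and, for $\omega\in C^1$, $\int\omega\,d\mu:=\langle\omega,\rho(\mu)\rangle$. $\mu$ is closed if $\int df\,d\mu=0$ for all $f\in C^0$, equivalently $\rho(\mu)\in H_1(\Gamma,\mathbb R)$; $\mathbb M\subset\mathbb P$ is the set of closed measures. Hamiltonian and Lagrangian. A Hamiltonian is a family $\mathcal H(e,\cdot):\mathbb R\to\mathbb R$, $e\in E$, with $\mathcal H(e,p)=\mathcal H(-e,-p)$, each strictly convex, differentiable and superlinear ($\mathcal H(e,p)/|p|\to+\infty$ as $p\to\pm\infty$). $p_e$ is the minimizer of $\mathcal H(e,\cdot)$, $a_e=\mathcal H(e,p_e)=a_{-e}$, and $\sigma(e,\cdot):[a_e,+\infty)\to[p_e,+\infty)$ is the inverse of $\mathcal H(e,\cdot)$ restricted to $[p_e,+\infty)$. $\mathcal L(e,q)=\max_p(pq-\mathcal H(e,p))$, well defined on $T\Gamma$. For $\omega\in C^1$: $\mathcal H^\omega(e,p)=\mathcal H(e,p+\omega(e))$, $\mathcal L^\omega(e,q)=\mathcal L(e,q)-q\,\omega(e)$, $\sigma^\omega(e,a)=\sigma(e,a)-\omega(e)$.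 For a path $\xi=(e_i)_{i=1}^M$ and $a\ge\max_ea_e$, $\sigma^\omega(\xi,a)=\sum_i\sigma^\omega(e_i,a)$. Mather theory. $\beta(h)=\min\{\int\mathcal L\,d\mu:\mu\in\mathbb M,\rho(\mu)=h\}$; $\alpha(c)=\max_h(\langle c,h\rangle-\beta(h))=-\min_{\mu\in\mathbb M}\int\mathcal L^\omega d\mu$ for any representative $\omega$ of $c$. $\mathbb M_c$ is the set of $\mu\in\mathbb M$ with $\int\mathcal L^\omega d\mu=-\alpha(c)$, and $\widetilde{\mathcal M}_c=\bigcup_{\mu\in\mathbb M_c}\operatorname{supp}\mu\subset T\Gamma$. $\pi_E$ is the multivalued projection $\pi_E(e,q)=\{e\}$ if $q>0$, $\pi_E(e,0)=\{e,-e\}$; the image of a set is the union of the images of its points. Weak KAM objects. A function $u:V\to\mathbb R$ is a subsolution at level $a$ if $\max_{e:\,t(e)=x}\mathcal H^\omega(e,du(e))\le a$ for every $x\in V$. The critical value $\widetilde\alpha(c)$ is the minimum of the $a\in\mathbb R$ for which subsolutions at level $a$ exist; it depends only on the class $c$ of $\omega$, is $\ge\max_ea_e$, and coincides with $\alpha(c)$. The Aubry set $\mathcal A_c\subset E$ is the set of edges belonging to some cycle $\xi$ with $\sigma^\omega(\xi,\widetilde\alpha(c))=0$; it contains $\mathcal M_c$. For $e\in\mathcal A_c$, $\mathcal Q_c(e):=\frac{\partial}{\partial p}\mathcal H^\omega(e,du(e))$, where $\omega$ is any representative of $c$ and $u$ any subsolution at level $\widetilde\alpha(c)$; this value is independent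 of $u$ and $\omega$ (indeed $du(e)=\sigma^\omega(e,\widetilde\alpha(c))$ on $\mathcal A_c$), and is nonnegative. *)

(* Defs.v *)
From HB Require Import structures.
From mathcomp Require Import all_boot all_order all_algebra generic_quotient.
From mathcomp Require Import all_classical all_reals all_analysis.
From mathcomp Require Import lra.

Set Implicit Arguments.
Unset Strict Implicit.
Unset Printing Implicit Defensive.

Import Order.TTheory GRing.Theory Num.Theory.
Import numFieldNormedType.Exports.

Local Open Scope classical_set_scope.
Local Open Scope ring_scope.
Local Open Scope quotient_scope.

Record graph := Graph {
  vertex : finType;
  edge : finType;
  orig : edge -> vertex;
  opp : edge -> edge;
  oppK : involutive opp;
  opp_neq : forall e, opp e != e;
  edge_card_gt0 : (0 < #|edge|)%N
}.

Section graph_theory.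
Variable G : graph.
Local Notation V := (vertex G).
Local Notation E := (edge G).

Definition term (e : E) : V := orig (opp e).

Definition next_edge : rel E := [rel e f | term e == orig f].

Definition linked (x y : V) : Prop :=
  exists e : E, exists s : seq E,
    [/\ path next_edge e s, orig e = x & term (last e s) = y].

Definition graph_connected : Prop := forall x y : V, linked x y.

Definition graph_loopless : Prop := forall e : E, orig e != term e.

(* MathComp's [cycle] adds the closing condition t(e_M) = o(e_1). *)
Definition graph_cycle (xi : seq E) : Prop := xi != [::] /\ cycle next_edge xi.

End graph_theory.

Section cohomology.
Variables (R : realType) (G : graph).
Local Notation V := (vertex G).
Local Notation E := (edge G).

Record cochain1 := Cochain1 {
  cochain1_fun :> {ffun E -> R};
  cochain1_antisym : [forall e, cochain1_fun (opp e) == - cochain1_fun e]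
}.

HB.instance Definition _ := [isSub for cochain1_fun].
HB.instance Definition _ := [Choice of cochain1 by <:].

Lemma cochain1_opp (w : cochain1) (e : E) : w (opp e) = - w e.
Proof. by have /forallP/(_ e)/eqP := cochain1_antisym w. Qed.

Definition dfun (g : V -> R) (e : E) : R := g (term e) - g (orig e).

Lemma dfun_antisym (g : V -> R) :
  [forall e, [ffun e => dfun g e] (opp e) == - [ffun e => dfun g e] e].
Proof.
by apply/forallP => e; rewrite !ffunE /dfun /term oppK opprB.
Qed.

Definition coboundary (g : V -> R) : cochain1 := Cochain1 (dfun_antisym g).

Definition cohomologous (w w' : cochain1) : bool :=
  `[< exists g : V -> R, forall e, w e - w' e = coboundary g e >].

Lemma cohomologous_refl : reflexive cohomologous.
Proof.
move=> w; apply/asboolP; exists (fun=> 0) => e.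
by rewrite ffunE /dfun !subrr.
Qed.

Lemma cohomologous_sym : symmetric cohomologous.
Proof.
suff H w w' : cohomologous w w' -> cohomologous w' w.
  by move=> w w'; apply/idP/idP; exact: H.
move=> /asboolP[g Hg]; apply/asboolP; exists (fun x => - g x) => e.
by have := Hg e; rewrite !ffunE /dfun; lra.
Qed.

Lemma cohomologous_trans : transitive cohomologous.
Proof.
move=> w2 w1 w3 /asboolP[g Hg] /asboolP[h Hh]; apply/asboolP.
exists (fun x => g x + h x) => e.
by have := Hg e; have := Hh e; rewrite !ffunE /dfun; lra.
Qed.

Canonical cohomologous_equiv :=
  EquivRel cohomologous
    cohomologous_refl cohomologous_sym cohomologous_trans.

Definition cohomology1 := {eq_quot cohomologous}.
HB.instance Definition _ := Choice.on cohomology1.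
HB.instance Definition _ := EqQuotient.on cohomology1.

(* Equality of the formal sums of edges z and z' modulo the span of the
   elements e + (-e): z - z' = \sum_e s(e) (e + (-e)). *)
Definition same_chain (z z' : {ffun E -> R}) : bool :=
  `[< exists s : E -> R, forall e, z e - z' e = s e + s (opp e) >].

Lemma same_chain_refl : reflexive same_chain.
Proof. by move=> z; apply/asboolP; exists (fun=> 0) => e; rewrite subrr addr0. Qed.

Lemma same_chain_sym : symmetric same_chain.
Proof.
suff H z z' : same_chain z z' -> same_chain z' z.
  by move=> z z'; apply/idP/idP; exact: H.
move=> /asboolP[s Hs]; apply/asboolP; exists (fun e => - s e) => e.
by have := Hs e; lra.
Qed.

Lemma same_chain_trans : transitive same_chain.
Proof.
move=> z2 z1 z3 /asboolP[s Hs] /asboolP[t Ht]; apply/asboolP.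
by exists (fun e => s e + t e) => e; have := Hs e; have := Ht e; lra.
Qed.

Canonical same_chain_equiv :=
  EquivRel same_chain same_chain_refl same_chain_sym same_chain_trans.

Definition chain1 := {eq_quot same_chain}.
HB.instance Definition _ := Choice.on chain1.
HB.instance Definition _ := EqQuotient.on chain1.

Definition bdry_formal (z : {ffun E -> R}) : {ffun V -> R} :=
  [ffun x => \sum_e z e * ((term e == x)%:R - (orig e == x)%:R)].

Definition bdry (h : chain1) : {ffun V -> R} := bdry_formal (repr h).

Definition homology1 : set chain1 := [set h | bdry h = [ffun=> 0]].

Definition pairing_formal (w : cochain1) (z : {ffun E -> R}) : R :=
  \sum_e z e * w e.

Definition pairing (w : cochain1) (h : chain1) : R := pairing_formal w (repr h).

(* Used only for h in [homology1], where it is the pairing of H^1 with H_1. *)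
Definition cpairing (c : cohomology1) (h : chain1) : R := pairing (repr c) h.

Lemma same_chain_pi (z : {ffun E -> R}) : same_chain (repr (\pi_chain1 z)) z.
Proof. by rewrite -[same_chain _ _]eqmodE; apply/eqP; rewrite reprK. Qed.

Lemma cohomologous_pi (w : cochain1) : cohomologous (repr (\pi_cohomology1 w)) w.
Proof. by rewrite -[cohomologous _ _]eqmodE; apply/eqP; rewrite reprK. Qed.

Let sum_antisym (f : E -> R) : (forall e, f (opp e) = - f e) -> \sum_e f e = 0.
Proof.
move=> fN; have : \sum_e f e = - \sum_e f e.
  rewrite -sumrN (reindex (@opp G)) /=.
    by apply: eq_bigr => e _; rewrite fN.
  by exists (@opp G) => e _; exact: oppK.
by lra.
Qed.

Let sum_same (z z' : {ffun E -> R}) (f : E -> R) : same_chain z z' ->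
  (forall e, f (opp e) = - f e) -> \sum_e z e * f e = \sum_e z' e * f e.
Proof.
move=> /asboolP[s Hs] fN; apply/eqP; rewrite -subr_eq0 -sumrB; apply/eqP.
rewrite (eq_bigr (fun e => (s e + s (opp e)) * f e)); last first.
  by move=> e _; rewrite -Hs mulrBl.
by apply: sum_antisym => e; rewrite oppK fN addrC mulrN.
Qed.

Lemma bdry_pi (z : {ffun E -> R}) : bdry (\pi_chain1 z) = bdry_formal z.
Proof.
apply/ffunP => x; rewrite !ffunE; apply: sum_same; first exact: same_chain_pi.
by move=> e; rewrite /term oppK opprB.
Qed.

Lemma pairing_pi (w : cochain1) (z : {ffun E -> R}) :
  pairing w (\pi_chain1 z) = pairing_formal w z.
Proof.
by apply: sum_same; [exact: same_chain_pi|move=> e; exact: cochain1_opp].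
Qed.

Lemma pairing_coboundary (g : V -> R) (h : chain1) :
  pairing (coboundary g) h = \sum_x g x * bdry h x.
Proof.
rewrite /pairing /pairing_formal /bdry.
under [RHS]eq_bigr => x _ do rewrite ffunE mulr_sumr.
rewrite exchange_big /=; apply: eq_bigr => e _; rewrite ffunE /dfun.
under eq_bigr => x _ do rewrite mulrCA mulrBr.
rewrite -mulr_sumr sumrB; congr (_ * (_ - _)).
- rewrite (bigD1 (term e)) //= eqxx mulr1 big1 ?addr0 // => x xe.
  by rewrite eq_sym (negbTE xe) mulr0.
- rewrite (bigD1 (orig e)) //= eqxx mulr1 big1 ?addr0 // => x xe.
  by rewrite eq_sym (negbTE xe) mulr0.
Qed.

Lemma cpairing_pi (w : cochain1) (h : chain1) :
  homology1 h -> cpairing (\pi_cohomology1 w) h = pairing w h.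
Proof.
move=> /= h0; have /asboolP[g Hg] := cohomologous_pi w.
have := pairing_coboundary g h; rewrite h0 [RHS]big1; last first.
  by move=> x _; rewrite ffunE mulr0.
rewrite /cpairing /pairing /pairing_formal => gh0.
apply/eqP; rewrite -subr_eq0 -sumrB -[eqbRHS]gh0; apply/eqP.
by apply: eq_bigr => e _; rewrite -mulrBr Hg.
Qed.

End cohomology.

Section tangent.
Variables (R : realType) (G : graph).
Local Notation V := (vertex G).
Local Notation E := (edge G).

Definition same_tangent (x y : E * {nonneg R}) : bool :=
  (x == y) || [&& y.1 == opp x.1, x.2%:num == 0 & y.2%:num == 0].

Lemma same_tangent_refl : reflexive same_tangent.
Proof. by move=> x; rewrite /same_tangent eqxx. Qed.

Lemma same_tangent_sym : symmetric same_tangent.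
Proof.
suff H x y : same_tangent x y -> same_tangent y x.
  by move=> x y; apply/idP/idP; exact: H.
case/orP => [/eqP->|/and3P[/eqP yx x0 y0]]; first exact: same_tangent_refl.
by rewrite /same_tangent x0 y0 yx oppK eqxx orbT.
Qed.

Lemma same_tangent_trans : transitive same_tangent.
Proof.
move=> y x z /orP[/eqP->//|/and3P[/eqP yx /eqP x0 /eqP y0]].
case/orP=> [/eqP<-|/and3P[/eqP zy _ /eqP z0]].
  by rewrite /same_tangent yx x0 y0 !eqxx orbT.
apply/orP; left; apply/eqP; case: x z x0 z0 yx zy => [e q] [f r] /= q0 r0 -> ->.
by rewrite oppK; congr (_, _); apply/val_inj; rewrite /= q0 r0.
Qed.

Canonical same_tangent_equiv :=
  EquivRel same_tangent
    same_tangent_refl same_tangent_sym same_tangent_trans.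

Definition tangent := {eq_quot same_tangent}.
HB.instance Definition _ := Choice.on tangent.
HB.instance Definition _ := EqQuotient.on tangent.

Definition tpoint (e : E) (q : {nonneg R}) : tangent := \pi_tangent (e, q).

Definition fiber (x : tangent) : R := (repr x).2%:num.

Lemma fiber_ge0 x : 0 <= fiber x.
Proof. by rewrite /fiber. Qed.

Definition half_line (e : E) : set tangent := range (tpoint e).

Definition tdist_formal (x y : E * {nonneg R}) : R :=
  if x.1 == y.1 then `|x.2%:num - y.2%:num|
  else if x.1 == opp y.1 then x.2%:num + y.2%:num
  else x.2%:num + y.2%:num + 1.

Definition tdist (x y : tangent) : R := tdist_formal (repr x) (repr y).

Let tdist_formal_sym x y : tdist_formal x y = tdist_formal y x.
Proof.
rewrite /tdist_formal [y.1 == x.1]eq_sym distrC.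
rewrite [y.2%:num + x.2%:num]addrC.
have -> : (y.1 == opp x.1) = (x.1 == opp y.1).
  by apply/eqP/eqP => ->; rewrite oppK.
by [].
Qed.

Lemma same_tangentP (x : E * {nonneg R}) : same_tangent (repr (\pi_tangent x)) x.
Proof. by rewrite -[same_tangent _ _]eqmodE; apply/eqP; rewrite reprK. Qed.

Let tdist_formal_compat x y z :
  same_tangent x y -> tdist_formal x z = tdist_formal y z.
Proof.
case/orP => [/eqP->//|/and3P[/eqP yx /eqP x0 /eqP y0]].
rewrite /tdist_formal yx x0 y0 !add0r normrN ger0_norm //.
have -> : (opp x.1 == opp z.1) = (x.1 == z.1) by rewrite (inj_eq (can_inj (@oppK G))).
have -> : (opp x.1 == z.1) = (x.1 == opp z.1).
  by apply/eqP/eqP => [<-|->]; rewrite oppK.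
by case: ifP; case: ifP.
Qed.

Lemma tdist_pi (x y : E * {nonneg R}) :
  tdist (\pi_tangent x) (\pi_tangent y) = tdist_formal x y.
Proof.
rewrite /tdist (tdist_formal_compat _ (same_tangentP x)) tdist_formal_sym.
by rewrite (tdist_formal_compat _ (same_tangentP y)) tdist_formal_sym.
Qed.

Let tdistxx x : tdist x x = 0.
Proof. by rewrite /tdist /tdist_formal eqxx subrr normr0. Qed.

Let tdist_positivity x y : tdist x y = 0 -> x = y.
Proof.
elim/quotW: x => x; elim/quotW: y => y; rewrite tdist_pi => d0.
apply/eqP; rewrite -[_ == _]/(_ == _ %[mod tangent]) eqmodE /=; move: d0.
rewrite /tdist_formal /same_tangent.
have x0 : 0 <= x.2%:num by []; have y0 : 0 <= y.2%:num by [].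
case: (eqVneq x.1 y.1) => [e12 d0|_].
  apply/orP; left; apply/eqP; rewrite [LHS]surjective_pairing [RHS]surjective_pairing.
  rewrite e12; congr pair; apply/val_inj => /=.
  by apply/eqP; rewrite -subr_eq0 -normr_eq0 d0.
case: eqP => [e12 d0|_ d0]; last by exfalso; lra.
rewrite e12 oppK eqxx /=.
have -> : x.2%:num = 0 by lra.
have -> : y.2%:num = 0 by lra.
by rewrite eqxx orbT.
Qed.

Let tdist_sym x y : tdist x y = tdist y x.
Proof. exact: tdist_formal_sym. Qed.

Let tdist_triangle y x z : tdist x z <= tdist x y + tdist y z.
Proof.
rewrite /tdist; move: (repr x) (repr y) (repr z) => [e q] [f r] [g s].
rewrite /tdist_formal /=.
have q0 : 0 <= q%:num by [].
have r0 : 0 <= r%:num by [].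
have s0 : 0 <= s%:num by [].
move: (q%:num) (r%:num) (s%:num) q0 r0 s0 => {q r s} q r s q0 r0 s0.
have N1 (a b : R) : a - b <= `|a - b| by exact: ler_norm.
have N2 (a b : R) : b - a <= `|a - b| by rewrite distrC ler_norm.
have := N1 q r; have := N2 q r; have := N1 r s; have := N2 r s.
have H : `|q - s| <= q + s by rewrite ler_norml; apply/andP; split; lra.
have T := ler_distD r q s.
move=> {N1 N2}.
case: (eqVneq e f) => [->|ef].
  case: (eqVneq f g) => [//|fg]; case: (eqVneq f (opp g)) => _; lra.
case: (eqVneq f g) => [->|fg].
  by rewrite eq_sym; case: (eqVneq e g) => [|_]; case: (eqVneq e (opp g)) => _; lra.
case: (eqVneq e (opp f)) => [ef'|ef'].
  case: (eqVneq f (opp g)) => [fg'|fg'].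
    by rewrite ef' fg' oppK eqxx; lra.
  by case: (eqVneq e g) => _; [lra|case: (eqVneq e (opp g)) => _; lra].
case: (eqVneq f (opp g)) => [fg'|fg'];
  by case: (eqVneq e g) => _; [lra|case: (eqVneq e (opp g)) => _; lra].
Qed.

HB.instance Definition _ := @isMetric.Build R tangent tdist
  tdistxx tdist_positivity tdist_sym tdist_triangle.

Let edge0 : E := enum_val (Ordinal (edge_card_gt0 G)).

HB.instance Definition _ := isPointed.Build tangent (tpoint edge0 0%:nng).

Definition tangentB := g_sigma_algebraType (@open tangent).

Definition piE (x : tangent) : set E :=
  if 0 < fiber x then [set (repr x).1]
  else [set (repr x).1; opp (repr x).1].

Lemma tpoint0 (e : E) (q : {nonneg R}) :
  q%:num = 0 -> tpoint (opp e) q = tpoint e q.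
Proof.
move=> q0; apply/eqP; rewrite -[_ == _]/(_ == _ %[mod tangent]) eqmodE /=.
by rewrite /same_tangent /= q0 oppK !eqxx orbT.
Qed.

Lemma fiber_tpoint (e : E) (q : {nonneg R}) : fiber (tpoint e q) = q%:num.
Proof.
rewrite /fiber; have /orP[/eqP->//|/and3P[_ /eqP-> /eqP/= ->]//] :=
  same_tangentP (e, q).
Qed.

Lemma piEP (x : tangent) (e : E) : piE x e <-> exists q, x = tpoint e q.
Proof.
have xE : x = tpoint (repr x).1 (repr x).2.
  by rewrite /tpoint -surjective_pairing reprK.
split.
- rewrite /piE; case: ifPn => [_ /= ->|]; first by exists (repr x).2.
  have f0 := fiber_ge0 x.
  rewrite -leNgt => f0' [->|->]; exists (repr x).2 => //.
  by rewrite tpoint0 //; apply/eqP; rewrite eq_le f0 f0'.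
- case=> q ->; have /orP[/eqP re|/and3P[/eqP/= re /eqP re0 _]] :=
    same_tangentP (e, q).
    by rewrite /piE /tpoint re /=; case: ifP => // _; left.
  by rewrite /piE /fiber re0 ltxx; right.
Qed.

End tangent.

Section measures.
Variables (R : realType) (G : graph).
Local Notation V := (vertex G).
Local Notation E := (edge G).
Local Notation T := (tangent R G).
Local Notation prob := (probability (tangentB R G) R).

Definition finite_moment : set prob :=
  [set mu : prob | (\int[mu]_x (fiber (x : T))%:E < +oo)%E].

Definition rotation (mu : prob) : chain1 R G :=
  \pi_(chain1 R G)
    [ffun e => fine (\int[mu]_(x in half_line e) (fiber (x : T))%:E)%E].

Definition closed_measure : set prob :=
  [set mu | finite_moment mu /\
            forall f : V -> R, pairing (coboundary f) (rotation mu) = 0].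

Definition msupport (mu : prob) : set T :=
  [set x | forall U : set T, open_nbhs x U -> (0 < mu U)%E].

End measures.

Record hamiltonian (R : realType) (G : graph) := Hamiltonian {
  ham :> edge G -> R -> R;
  ham_opp : forall e p, ham e p = ham (opp e) (- p);
  ham_strictly_convex : forall e (p1 p2 t : R), p1 != p2 -> 0 < t -> t < 1 ->
    ham e (t * p1 + (1 - t) * p2) < t * ham e p1 + (1 - t) * ham e p2;
  ham_derivable : forall e p, derivable (ham e) p 1;
  ham_superlinear_pinfty : forall e,
    ham e p / `|p| @[p --> +oo%R] --> +oo%R;
  ham_superlinear_ninfty : forall e,
    ham e p / `|p| @[p --> -oo%R] --> +oo%R
}.

Section mather.
Variables (R : realType) (G : graph) (H : hamiltonian R G).
Local Notation V := (vertex G).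
Local Notation E := (edge G).
Local Notation T := (tangent R G).
Local Notation prob := (probability (tangentB R G) R).
Implicit Types (w : cochain1 R G) (c : cohomology1 R G) (e : E) (u : V -> R).

Definition pmin e : R := get [set p | forall p', H e p <= H e p'].

Definition sigma e : R -> R := pinv [set` `[pmin e, +oo[] (H e).

Definition lagrangian e (q : R) : R := sup (range (fun p => p * q - H e p)).

Definition hamw w e (p : R) : R := H e (p + w e).
Definition lagw w e (q : R) : R := lagrangian e q - q * w e.
Definition sigmaw w e (a : R) : R := sigma e a - w e.

Definition sigmaw_path w (xi : seq E) (a : R) : R :=
  \sum_(e <- xi) sigmaw w e a.

Definition lagT (x : T) : R := lagrangian (repr x).1 (fiber x).
Definition lagwT w (x : T) : R := lagw w (repr x).1 (fiber x).

Lemma lagrangian_opp0 e : lagrangian (opp e) 0 = lagrangian e 0.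
Proof.
rewrite /lagrangian; congr sup; apply/seteqP; split=> _ [p _ <-];
  exists (- p) => //; rewrite !mulr0 ham_opp ?opprK //.
by rewrite oppK.
Qed.

Lemma lagT_tpoint e (q : {nonneg R}) : lagT (tpoint e q) = lagrangian e q%:num.
Proof.
rewrite /lagT fiber_tpoint; have := same_tangentP (e, q); rewrite -/(tpoint e q).
case/orP => [/eqP->//|/and3P[/eqP /= re _ /eqP ->]].
by rewrite [in RHS]re lagrangian_opp0.
Qed.

Lemma lagwT_tpoint w e (q : {nonneg R}) :
  lagwT w (tpoint e q) = lagw w e q%:num.
Proof.
rewrite /lagwT /lagw -[lagrangian (repr _).1 _]/(lagT _) lagT_tpoint fiber_tpoint.
have /orP[/eqP->//|] := same_tangentP (e, q).
by case/and3P => _ _ /eqP /= ->; rewrite !mul0r.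
Qed.

(* The infimum below is attained, as is the supremum in [mather_alpha]; both
   values are finite. *)
Definition mather_beta (h : chain1 R G) : \bar R :=
  ereal_inf [set (\int[mu]_x (lagT x)%:E)%E | mu in
    [set mu : prob | closed_measure mu /\ rotation mu = h]].

Definition mather_alpha c : \bar R :=
  ereal_sup [set ((cpairing c h)%:E - mather_beta h)%E | h in @homology1 R G].

(* The integral of [lagwT w] against a closed measure depends only on the class
   of w, so [repr c] may be any representative; for [critical_value] and
   [aubry_set] see [critical_value_pi] and [sigmaw_cycle]. *)
Definition minimizing_measure c : set prob :=
  [set mu : prob | closed_measure mu /\
    (\int[mu]_x (lagwT (repr c) x)%:E = - mather_alpha c)%E].

Definition mather_set c : set T :=
  \bigcup_(mu in minimizing_measure c) msupport mu.

Definition projected_mather_set c : set E :=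
  \bigcup_(x in mather_set c) piE x.

Definition subsolution w (a : R) u : Prop :=
  forall (x : V) e, term e = x -> hamw w e (dfun u e) <= a.

(* The infimum is attained. *)
Definition critical_value c : R :=
  inf [set a | exists u, subsolution (repr c) a u].

Lemma subsolution_shift w w' a u (g : V -> R) :
  (forall e, w e - w' e = coboundary g e) ->
  subsolution w a u -> subsolution w' a (fun x => u x + g x).
Proof.
move=> ww' su x e ex; have := su x e ex; congr (_ <= _); congr (H e _).
by have := ww' e; rewrite ffunE /dfun; lra.
Qed.

Lemma critical_value_pi w :
  critical_value (\pi_(cohomology1 R G) w) =
  inf [set a | exists u, subsolution w a u].
Proof.
have cw := cohomologous_pi w; congr inf; apply/seteqP; split => a [u su].
- by have /asboolP[g Hg] := cw; exists (fun x => u x + g x);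
    apply: subsolution_shift su.
- move: cw; rewrite cohomologous_sym => /asboolP[g Hg].
  by exists (fun x => u x + g x); apply: subsolution_shift su.
Qed.

Lemma sigmaw_cycle w w' (xi : seq E) a : cohomologous w w' -> graph_cycle xi ->
  sigmaw_path w xi a = sigmaw_path w' xi a.
Proof.
move=> /asboolP[g Hg] [_ cxi]; apply/eqP; rewrite -subr_eq0 -sumrB.
rewrite (eq_bigr (fun e => - dfun g e)); last first.
  by move=> e _; have := Hg e; rewrite ffunE /sigmaw; lra.
rewrite sumrN oppr_eq0.
have tele e s : path (@next_edge G) e s ->
    \sum_(f <- e :: s) dfun g f = g (term (last e s)) - g (orig e).
  elim: s e => [|f s IH] e /=; first by rewrite big_seq1.
  case/andP => /eqP ef pfs; rewrite big_cons IH // /dfun ef; lra.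
case: xi cxi => [|e s] /=; first by rewrite big_nil.
by rewrite rcons_path => /andP[es /eqP le]; rewrite tele // le subrr.
Qed.

Definition aubry_set c : set E :=
  [set e | exists xi : seq E, [/\ graph_cycle xi, e \in xi &
    sigmaw_path (repr c) xi (critical_value c) = 0]].

(* Common value of dH^w/dp (e, du(e)) over the representatives w of c and the
   critical subsolutions u; this value is unique only for e in the Aubry set. *)
Definition Qspeed c e : R :=
  get [set q | exists w u, [/\ \pi_(cohomology1 R G) w = c,
    subsolution w (critical_value c) u & q = derive1 (hamw w e) (dfun u e)]].

End mather.

(* Main.v *)
(* Put a = alpha(c). If a cochain w of class c satisfies H(e, w(e)) <= a on every
   edge, then L^w + a >= 0 by Fenchel's inequality, and its integral against a
   minimizing measure is 0. Since L^w is lower semicontinuous, L^w = -a on the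
   whole support, and the equality case of Fenchel's inequality at (e, q) forces
   q = H'(e, w(e)) and sigma(e, a) = w(e). So the support has at most one point
   over e, at height Q_c(e). Moreover sigma^w(., a) vanishes on these edges, so any
   cycle of such edges is critical: for q = 0 take (e, -e), and for q > 0 the
   edge e carries positive flux of a circulation, hence lies on a cycle of edges
   with positive flux.

   Such a w exists: testing alpha(c) against measures carried by a cycle shows
   that inf_{q > 0} (L^w(e, q) + a) / q is a cost without negative cycles, whose
   shortest-walk potential is a subsolution at level a. In particular the
   critical value equals a. *)

Require Import Defs.
From HB Require Import structures.
From mathcomp Require Import all_boot all_order all_algebra generic_quotient.
From mathcomp Require Import all_classical all_reals all_analysis.
From mathcomp Require Import measurable_realfun lra ring.

Set Implicit Arguments.
Unset Strict Implicit.
Unset Printing Implicit Defensive.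

Import Order.TTheory GRing.Theory Num.Theory.
Import numFieldNormedType.Exports.

Local Open Scope classical_set_scope.
Local Open Scope ring_scope.
Local Open Scope quotient_scope.

(** * Convexity of the Hamiltonian *)

Section hamiltonian_facts.
Variables (R : realType) (G : graph) (H : hamiltonian R G).
Implicit Types (e : edge G) (p q : R).

(** Superlinearity at both ends in a single bound: the coercivity behind minimizers and finite
    Lagrangians. *)
Lemma ham_above_cone e (k : R) :
  exists2 M, 0 < M & forall p, M < `|p| -> k * `|p| <= H e p.
Proof.
have /cvgryPge/(_ k)[M1 [_ M1P]] := @ham_superlinear_pinfty _ _ H e.
have /cvgryPge/(_ k)[M2 [_ M2P]] := @ham_superlinear_ninfty _ _ H e.
exists (`|M1| + `|M2| + 1) => [|p pM]; first by rewrite ltr_pwDr.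
have n1 := ler_norm M1; have n2 := ler_norm (- M2); rewrite normrN in n2.
have n10 := normr_ge0 M1; have n20 := normr_ge0 M2.
have p0 : 0 < `|p| by lra.
rewrite -ler_pdivlMr //; have [sp|sp] := leP 0 p.
- by apply: M1P; have := ger0_norm sp; lra.
- by apply: M2P; have := ltr0_norm sp; lra.
Qed.

Lemma ham_continuous e : continuous (H e).
Proof.
move=> p; apply: differentiable_continuous.
exact/derivable1_diffP/ham_derivable.
Qed.

Lemma ham_has_minimizer e : exists p, forall p', H e p <= H e p'.
Proof.
have [M M0 HM] := ham_above_cone e (`|H e 0| + 1).
(* [N] exceeds both [M] and 1, so for [|p'| > N] the cone of slope [|H e 0| + 1] lies above
   [H e 0]. *)
pose N := M + 1.
have [||p _ pmin_] := @EVT_min _ (H e) (- N) N.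
- by rewrite /N; lra.
- exact/continuous_subspaceT/ham_continuous.
have p0 : H e p <= H e 0 by apply: pmin_; rewrite in_itv /= /N; apply/andP; split; lra.
exists p => p'; case: (lerP `|p'| N) => [|Np'].
  by rewrite ler_norml => ?; apply: pmin_; rewrite in_itv.
apply: (le_trans p0); apply: le_trans (HM p' _); last by rewrite /N in Np'; lra.
apply: (le_trans (ler_norm _)); rewrite /N in Np'.
have := normr_ge0 (H e 0); nra.
Qed.

Lemma ham_pmin_le e p : H e (pmin H e) <= H e p.
Proof. exact: (getPex (ham_has_minimizer e)). Qed.

Lemma ham_convex e p p' (t : R) : 0 <= t <= 1 ->
  H e (t * p + (1 - t) * p') <= t * H e p + (1 - t) * H e p'.
Proof.
case/andP => t0 t1; have [->|pp'] := eqVneq p p'.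
  by rewrite -!mulrDl addrC subrK !mul1r.
have [->|t0'] := eqVneq t 0; first by rewrite !mul0r subr0 !mul1r !add0r.
have [->|t1'] := eqVneq t 1; first by rewrite subrr !mul0r !mul1r !addr0.
by apply/ltW/ham_strictly_convex => //; rewrite lt_neqAle ?t0 ?t1 ?andbT // eq_sym.
Qed.

(** At the midpoint of two distinct minimizers strict convexity would go below the minimum. *)
Lemma ham_minimizer_unique e p :
  (forall p', H e p <= H e p') -> p = pmin H e.
Proof.
move=> pm; apply/eqP; apply: contraT => ne.
have := @ham_strictly_convex _ _ H e _ _ 2^-1 ne; rewrite invr_gt0 ltr0n => /(_ isT).
have -> : 2^-1 < 1 :> R by rewrite invf_lt1 ?ltr1n.
move=> /(_ isT); set m := (_ + _).
by have := ham_pmin_le e m; have := pm (pmin H e); have := ham_pmin_le e p; lra.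
Qed.

Lemma ham_increasing e p p' : pmin H e <= p -> p < p' -> H e p < H e p'.
Proof.
rewrite le_eqVlt => /orP[/eqP<-|pp] pp'.
  rewrite lt_neqAle ham_pmin_le andbT; apply/negP => /eqP Hpp'.
  have : p' = pmin H e by apply: ham_minimizer_unique => x; rewrite -Hpp' ham_pmin_le.
  by move=> p'E; rewrite p'E ltxx in pp'.
have d0 : 0 < p' - pmin H e by lra.
(* The weight that makes [p] a convex combination of [pmin H e] and [p']. *)
pose t := (p' - p) / (p' - pmin H e).
have t0 : 0 < t by rewrite divr_gt0 //; lra.
have t1 : t < 1 by rewrite ltr_pdivrMr //; lra.
have ne : pmin H e != p' by apply/eqP; lra.
have := @ham_strictly_convex _ _ H e _ _ t ne t0 t1.
have -> : t * pmin H e + (1 - t) * p' = p.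
  by rewrite /t; field; lra.
have := ham_pmin_le e p'; have: 0 < 1 - t by lra.
by nra.
Qed.

(** [pinv] inverts an injective function on its image, so strict monotonicity right of the minimizer
    suffices. *)
Lemma sigma_ham e p : pmin H e <= p -> sigma H e (H e p) = p.
Proof.
move=> pp; rewrite /sigma pinvKV //; last by rewrite inE /= in_itv /= pp.
move=> x y; rewrite !inE /= !in_itv /= !andbT => px py Hxy.
case: (ltgtP x y) => // xy.
- by have := ham_increasing px xy; rewrite Hxy ltxx.
- by have := ham_increasing py xy; rewrite Hxy ltxx.
Qed.

(** By convexity the difference quotients along [p' - p] with step in (0, 1) are at most
    [H e p' - H e p]; pass to the limit. *)
Lemma ham_tangent e p p' : H e p + derive1 (H e) p * (p' - p) <= H e p'.
Proof.
have df : differentiable (H e) p by apply/derivable1_diffP/ham_derivable.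
have := @diff_derivable _ _ _ _ _ (p' - p) df => /cvg_dnbhs_at_right dv.
have <- : 'D_(p' - p) (H e) p = derive1 (H e) p * (p' - p).
  by rewrite derive1E' // deriveE // mulrC -[in LHS](mulr1 (p' - p)) linearZ.
rewrite addrC -lerBrDr; apply: (cvgr_to_le dv).
near=> h.
have h0 : 0 < h by near: h; exact: nbhs_right_gt.
have h1 : h < 1 by near: h; exact: nbhs_right_lt.
rewrite /= /GRing.scale /= mulrC ler_pdivrMr //.
have -> : h * (p' - p) + p = h * p' + (1 - h) * p by ring.
have := @ham_convex e p' p h; rewrite (ltW h0) (ltW h1) => /(_ isT); lra.
Unshelve. all: by end_near. Qed.

(** Beyond the radius [M] of the cone of slope [|q|] the expression is at most 0; inside, the
    minimum of [H e] controls it. *)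
Lemma lagrangian_has_sup e q : has_sup (range (fun p => p * q - H e p)).
Proof.
split; first by exists (0 * q - H e 0), 0.
have [M M0 HM] := ham_above_cone e `|q|.
exists (M * `|q| + `|H e (pmin H e)|) => _ [p _ <-].
have n1 := normr_ge0 q; have n2 := normr_ge0 (H e (pmin H e)).
have pq : p * q <= `|p| * `|q| by rewrite -normrM ler_norm.
case: (lerP `|p| M) => pM.
  have : `|p| * `|q| <= M * `|q| by rewrite ler_wpM2r.
  have := ham_pmin_le e p; have := ler_norm (- H e (pmin H e)); rewrite normrN.
  by lra.
have : 0 <= M * `|q| by rewrite mulr_ge0 // ltW.
by have := HM _ pM; rewrite mulrC; lra.
Qed.

Lemma fenchel_young e p q : p * q - H e p <= lagrangian H e q.
Proof. by apply: sup_ubound; [case: (lagrangian_has_sup e q)|exists p]. Qed.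

Lemma lagrangian_le e q (b : R) :
  (forall p, p * q - H e p <= b) -> lagrangian H e q <= b.
Proof.
move=> ub; apply: ge_sup; first by case: (lagrangian_has_sup e q).
by move=> _ [p _ <-].
Qed.

Lemma lagrangian_derive e p :
  lagrangian H e (derive1 (H e) p) = p * derive1 (H e) p - H e p.
Proof.
apply/eqP; rewrite eq_le fenchel_young andbT; apply: lagrangian_le => p'.
by have := ham_tangent e p p'; lra.
Qed.

Lemma lagrangian0 e : lagrangian H e 0 = - H e (pmin H e).
Proof.
apply/eqP; rewrite eq_le; apply/andP; split.
  by apply: lagrangian_le => p; have := ham_pmin_le e p; lra.
by have := fenchel_young e (pmin H e) 0; lra.
Qed.

Lemma derive_pmin_ge0 e p : pmin H e < p -> 0 <= derive1 (H e) p.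
Proof.
move=> pp; have := ham_tangent e p (pmin H e); have := ham_pmin_le e p.
move: (derive1 _ _) => d; nra.
Qed.

(** Equality makes [p] a maximizer of [p' * q - H e p'], whence the first-order condition. As [q] is
    nonnegative, a [p] left of [pmin H e] would be a second minimizer of [H e]. *)
Lemma fenchel_young_eq e p q : 0 <= q -> lagrangian H e q <= p * q - H e p ->
  pmin H e <= p /\ derive1 (H e) p = q.
Proof.
move=> q0 Lq.
have Hle p' : p' * q - H e p' <= p * q - H e p.
  exact: le_trans (fenchel_young e p' q) Lq.
split.
  rewrite leNgt; apply/negP => pp; suff pE : p = pmin H e by rewrite -pE ltxx in pp.
  apply: ham_minimizer_unique => p'; apply: le_trans (ham_pmin_le e p').
  by have := Hle (pmin H e); nra.
have dH : is_derive p 1 (H e) (derive1 (H e) p).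
  by rewrite derive1E; apply/derivableP/ham_derivable.
have dg : is_derive p 1 (H e - q \*: id) (derive1 (H e) p - q *: 1) by exact: is_deriveB.
have : is_derive p 1 (H e - q \*: id) 0.
  apply: (@derive1_at_min _ _ (p - 1) (p + 1)).
  - lra.
  - move=> t _; apply: derivableB; first exact: ham_derivable.
    exact: derivableZ.
  - by rewrite in_itv /=; apply/andP; split; lra.
  - by move=> t _; have := Hle t; rewrite !fctE /= /GRing.scale /=; lra.
move=> /@derive_val; rewrite derive_val => /eqP.
by rewrite subr_eq0 [q *: 1]mulr1 => /eqP.
Qed.

End hamiltonian_facts.

(** * Topology of the tangent bundle *)

Section tangent_facts.
Variables (R : realType) (G : graph).
Local Notation E := (edge G).
Local Notation T := (tangent R G).
Implicit Types (e f : E) (q s : {nonneg R}).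

Lemma tangentW (P : T -> Prop) : (forall e q, P (tpoint e q)) -> forall x, P x.
Proof. by move=> Pt; elim/quotW => -[e q]; exact: Pt. Qed.

Lemma tpoint_eq e f q s : tpoint e q = tpoint f s <->
  (e = f /\ q%:num = s%:num) \/ [/\ f = Defs.opp e, q%:num = 0 & s%:num = 0].
Proof.
split=> [/eqP|].
  rewrite -[_ == _]/(_ == _ %[mod tangent R G]) eqmodE /=.
  case/orP=> [/eqP[-> ->]|/and3P[/= /eqP ? /eqP ? /eqP ?]]; first by left.
  by right.
move=> [[-> /val_inj ->] //|[-> q0 s0]].
by rewrite tpoint0 //; congr tpoint; apply/val_inj; rewrite /= q0 s0.
Qed.

Lemma half_lineE e (x : T) : half_line e x <-> Defs.piE x e.
Proof.
rewrite piEP; split=> [[q _ <-]|[q ->]]; by [exists q|exists q].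
Qed.

Lemma open_tangent (U : set T) :
  (forall x, U x -> exists2 r, 0 < r & forall y, tdist x y < r -> U y) -> open U.
Proof.
move=> UP; rewrite openE => x /UP[r r0 rU].
by apply/nbhs_ballP; exists r.
Qed.

(** A ball of radius 1 meets only the half-lines of [e] and its opposite, which is why the radii
    below are capped at 1. *)
Lemma tdist_tpoint e q f s : tdist (tpoint e q) (tpoint f s) < 1 ->
  (f = e /\ tdist (tpoint e q) (tpoint f s) = `|q%:num - s%:num|) \/
  (f = Defs.opp e /\ tdist (tpoint e q) (tpoint f s) = q%:num + s%:num).
Proof.
rewrite tdist_pi /tdist_formal /=; case: eqP => [<-|_]; first by left.
case: eqP => [->|_]; first by rewrite oppK; right.
have q0 : 0 <= q%:num by [].
have s0 : 0 <= s%:num by [].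
lra.
Qed.

Lemma open_fiber_gt (t : R) : open [set x : T | t < fiber x].
Proof.
apply: open_tangent; elim/tangentW => e q; rewrite /= fiber_tpoint => tq.
exists (Num.min 1 (q%:num - t)); first by rewrite lt_min ltr01 subr_gt0.
elim/tangentW => f s; rewrite lt_min /= fiber_tpoint => /andP[/tdist_tpoint].
have q0 : 0 <= q%:num by [].
have s0 : 0 <= s%:num by [].
case=> -[_ ->]; last by lra.
have := ler_norm (q%:num - s%:num); lra.
Qed.

(** The point of height 0 is shared with the opposite half-line, so it has to be removed; a point of
    height [q] is at distance at least [q] from that half-line. *)
Lemma open_half_line_pos e : open [set x : T | half_line e x /\ 0 < fiber x].
Proof.
apply: open_tangent; elim/tangentW => f q [/half_lineE/piEP[q' /tpoint_eq fe]].
rewrite fiber_tpoint => q0.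
have {fe q'} -> : f = e by case: fe => [[]|[_ qz _]] //; exfalso; lra.
exists (Num.min 1 q%:num); first by rewrite lt_min ltr01.
elim/tangentW => g s; rewrite lt_min /= fiber_tpoint => /andP[/tdist_tpoint].
have s0 : 0 <= s%:num by [].
case=> -[-> ->]; last by lra.
have := ler_norm (q%:num - s%:num); split; last by lra.
by exists s.
Qed.

Lemma open_half_lineC e : open (~` half_line e : set T).
Proof.
apply: open_tangent; elim/tangentW => f q /= fNe.
have fe : f <> e by move=> fe; apply: fNe; exists q => //; rewrite fe.
have [fe'|fe'] := pselect (f = Defs.opp e); last first.
  exists 1 => //; elim/tangentW => g s /tdist_tpoint gf [r _ /esym/tpoint_eq].
  have {}gf : g = f \/ g = Defs.opp f by case: gf => -[-> _]; [left|right].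
  move=> [[ge _]|[ge _ _]].
  - by case: gf => gf; [apply: fe; rewrite -gf|apply: fe'; rewrite -ge gf oppK].
  - case: gf => gf; [apply: fe'; rewrite ge oppK -gf|apply: fe].
      by [].
    by rewrite ge gf oppK.
(* Over the opposite edge height 0 is excluded, since that point also lies on [half_line e]. *)
have q0 : 0 < q%:num.
  rewrite lt_neqAle; apply/andP; split=> //; apply/negP => /eqP q0.
  by apply: fNe; exists q => //; rewrite fe' tpoint0.
exists (Num.min 1 q%:num); first by rewrite lt_min ltr01.
elim/tangentW => g s; rewrite lt_min => /andP[/tdist_tpoint].
have s0 : 0 <= s%:num by [].
case=> -[-> ->]; last by lra.
move=> /ltr_normlW qs [r _ /esym/tpoint_eq[[/fe]|[_ sz _]]] //.
by rewrite sz subr0 ltxx in qs.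
Qed.

Lemma open_measurable (U : set T) : open U -> measurable (U : set (tangentB R G)).
Proof. by move=> oU; exact: sub_sigma_algebra. Qed.

Lemma measurable_half_line e : measurable (half_line e : set (tangentB R G)).
Proof.
rewrite -[X in measurable X]setCK; apply: measurableC.
by apply: open_measurable; exact: open_half_lineC.
Qed.

Lemma measurable_lsc (f : T -> R) :
  (forall t, open [set x | t < f x]) -> measurable_fun [set: tangentB R G] f.
Proof.
move=> of_; apply: (measurability _ (@RGenOInfty.measurableE R)).
move=> _ [_ [t ->] <-]; rewrite setTI.
have -> : f @^-1` `]t, +oo[%classic = [set x | t < f x].
  by apply/seteqP; split => x /=; rewrite in_itv /= andbT.
exact: open_measurable.
Qed.

Lemma measurable_fiber : measurable_fun [set: tangentB R G] (@fiber R G).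
Proof. apply: measurable_lsc; exact: open_fiber_gt. Qed.

Variable H : hamiltonian R G.

(** Lower semicontinuity: [lagwT] is a supremum of affine functions of slope [p - w e], and each
    continues across height 0 with momentum [- p] on the opposite half-line. *)
Lemma open_lagwT_gt (w : cochain1 R G) (t : R) : open [set x | t < lagwT H w x].
Proof.
apply: open_tangent; elim/tangentW => e q; rewrite /= lagwT_tpoint /lagw => tL.
have [p tp] : exists p, t < p * q%:num - H e p - q%:num * w e.
  apply: contrapT => /forallNP tN.
  have : lagrangian H e q%:num <= t + q%:num * w e.
    by apply: lagrangian_le => p; have /negP := tN p; rewrite -leNgt; lra.
  by move: tL; lra.
pose d := p * q%:num - H e p - q%:num * w e - t.
have d0 : 0 < d by rewrite /d; lra.
have n0 := normr_ge0 (p - w e).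
(* [d] is the margin at the centre and [|p - w e|] the Lipschitz constant of the affine minorant;
   the added 1 keeps the divisor positive. *)
exists (Num.min 1 (d / (`|p - w e| + 1))).
  by rewrite lt_min ltr01 divr_gt0 //; lra.
elim/tangentW => f s; rewrite lt_min /= lagwT_tpoint /lagw => /andP[/tdist_tpoint].
have s0 : 0 <= s%:num by [].
have q0 : 0 <= q%:num by [].
rewrite ltr_pdivlMr; last by lra.
case=> -[-> ->].
- have := fenchel_young H e p s%:num.
  have := ler_norm ((q%:num - s%:num) * (p - w e)); rewrite normrM.
  have := normr_ge0 (q%:num - s%:num).
  rewrite /d; nra.
- have := fenchel_young H (Defs.opp e) (- p) s%:num; rewrite -ham_opp cochain1_opp.
  have := ler_norm ((q%:num + s%:num) * (p - w e)).
  rewrite normrM [`|_ + _|]ger0_norm; last by lra.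
  rewrite /d; nra.
Qed.

Lemma measurable_lagwT (w : cochain1 R G) :
  measurable_fun [set: tangentB R G] (lagwT H w).
Proof. apply: measurable_lsc; exact: open_lagwT_gt. Qed.

End tangent_facts.

(** * Flux and discrete measures *)

Section flux.
Variables (R : realType) (G : graph).
Local Notation E := (edge G).
Local Notation T := (tangent R G).
Local Notation TB := (tangentB R G).
Implicit Types (w : cochain1 R G) (e f : E) (mu : probability TB R).

(** The 1-form [w] as a function on the tangent bundle; it vanishes at height 0, so the choice of
    representative does not affect it. *)
Definition flux w (x : T) : R := fiber x * w (repr x).1.

Lemma flux_tpoint w e (q : {nonneg R}) : flux w (tpoint e q) = q%:num * w e.
Proof.
rewrite /flux fiber_tpoint; have /orP[/eqP->//|] := same_tangentP (e, q).
by case/and3P => _ _ /eqP /= ->; rewrite !mul0r.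
Qed.

(** Half-lines overlap only at height 0, where [fiber] vanishes. The sum matches the edgewise
    integrals in [rotation]. *)
Lemma flux_sum w (x : T) : (flux w x)%:E =
  (\sum_e (w e)%:E * ((fun x => (fiber x)%:E) \_ (half_line e)) x)%E.
Proof.
elim/tangentW: x => f q; rewrite flux_tpoint (bigD1 f) //= big1; last first.
  move=> e ef; rewrite patchE; case: ifPn; last by rewrite mule0.
  rewrite inE => -[r _ /esym/tpoint_eq[[fe]|[_ q0 _]]]; first by rewrite fe eqxx in ef.
  by rewrite fiber_tpoint q0 mule0.
by rewrite patchE mem_set ?fiber_tpoint ?adde0 -?EFinM 1?mulrC//; exists q.
Qed.

Lemma integrable_fiber mu : finite_moment mu ->
  mu.-integrable setT (fun x => (fiber (x : T))%:E).
Proof.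
move=> fm; apply/integrableP; split.
  by apply/measurable_EFinP; exact: measurable_fiber.
under eq_integral do rewrite gee0_abs ?lee_fin ?fiber_ge0 //.
exact: fm.
Qed.

Lemma integrable_fiber_half_line mu e : finite_moment mu ->
  mu.-integrable setT ((fun x : TB => (fiber (x : T))%:E) \_ (half_line e)).
Proof.
move=> fm; apply/(integrable_mkcond _ (measurable_half_line e)).
apply: integrableS (integrable_fiber fm) => //; exact: measurable_half_line.
Qed.

Lemma integrable_flux mu w : finite_moment mu ->
  mu.-integrable setT (fun x => (flux w (x : T))%:E).
Proof.
move=> fm; under eq_fun do rewrite flux_sum.
by apply: integrable_sum => // e _; apply/integrableZl/integrable_fiber_half_line.
Qed.

Lemma integral_flux mu w : finite_moment mu ->
  (\int[mu]_x (flux w (x : T))%:E)%E = (pairing w (rotation mu))%:E.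
Proof.
move=> fm; under eq_integral do rewrite flux_sum.
rewrite integral_sum //; last first.
  by move=> e; apply: integrableZl => //; exact: integrable_fiber_half_line.
rewrite /rotation pairing_pi /pairing_formal -sumEFin; apply: eq_bigr => e _.
rewrite integralZl //; last exact: integrable_fiber_half_line.
rewrite ffunE -integral_mkcond EFinM muleC fineK //.
apply: integrable_fin_num; first exact: measurable_half_line.
by apply: integrableS (integrable_fiber fm) => //; exact: measurable_half_line.
Qed.

End flux.

Section discrete.
Variables (R : realType) (G : graph).
Local Notation TB := (tangentB R G).

Definition discrete_measure n (lam : nat -> {nonneg R}) (x : nat -> TB)
    (lam1 : \sum_(i < n) (lam i)%:num = 1) : set TB -> \bar R :=
  msum (fun i => mscale (lam i) \d_(x i)) n.

HB.instance Definition _ n lam x lam1 := Measure.on (@discrete_measure n lam x lam1).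

Lemma discrete_measureT n lam x lam1 :
  @discrete_measure n lam x lam1 setT = 1%E.
Proof.
rewrite /discrete_measure /msum /= -lam1 -sumEFin; apply: eq_bigr => i _.
by rewrite /mscale /= diracT mule1.
Qed.

HB.instance Definition _ n lam x lam1 := Measure_isProbability.Build _ _ _
  (@discrete_measure n lam x lam1) (discrete_measureT x lam1).

Lemma ge0_integral_discrete n lam x lam1 (f : TB -> R) :
  measurable_fun setT f -> (forall x, 0 <= f x) ->
  (\int[@discrete_measure n lam x lam1]_x (f x)%:E =
   (\sum_(i < n) (lam i)%:num * f (x i))%:E)%E.
Proof.
move=> /measurable_EFinP mf f0.
rewrite ge0_integral_measure_sum //; last by move=> *; rewrite lee_fin.
rewrite -sumEFin; apply: eq_bigr => i _.
rewrite ge0_integral_mscale //; last by move=> *; rewrite lee_fin.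
by rewrite integral_dirac //= diracT mul1e EFinM.
Qed.

Lemma integral_discrete n lam x lam1 (f : TB -> R) :
  measurable_fun setT f ->
  (\int[@discrete_measure n lam x lam1]_x (f x)%:E =
   (\sum_(i < n) (lam i)%:num * f (x i))%:E)%E.
Proof.
move=> mf; rewrite integralE.
under eq_integral do rewrite -/((EFin \o f)^\+%E _) funerpos.
under [X in (_ - X)%E]eq_integral do rewrite -/((EFin \o f)^\-%E _) funerneg.
rewrite !ge0_integral_discrete //; do ?exact: measurable_funrpos;
  do ?exact: measurable_funrneg.
rewrite -EFinB -sumrB; congr EFin; apply: eq_bigr => i _.
by rewrite -mulrBr -[in RHS](funrposBneg f).
Qed.

End discrete.

(** * Bounds on alpha *)

(** The action of a measure may be infinite, so positive and negative parts are compared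
    separately. *)
Lemma measurable_le_integral d (T : measurableType d) (R : realType)
    (mu : {measure set T -> \bar R}) (f g : T -> \bar R) :
  measurable_fun setT f -> measurable_fun setT g -> (forall x, f x <= g x)%E ->
  (\int[mu]_x f x <= \int[mu]_x g x)%E.
Proof.
move=> mf mg fg; rewrite integralE [leRHS]integralE leeB//.
- apply: ge0_le_integral => //.
  + exact: measurable_funepos.
  + exact: measurable_funepos.
  + by move=> x _; apply: (@funepos_le _ _ setT) => //; rewrite inE.
- apply: ge0_le_integral => //.
  + exact: measurable_funeneg.
  + exact: measurable_funeneg.
  + by move=> x _; apply: (@funeneg_le _ _ setT) => //; rewrite inE.
Qed.

Section cochain_facts.
Variables (R : realType) (G : graph).
Local Notation V := (vertex G).
Local Notation E := (edge G).
Implicit Types (w : cochain1 R G) (u : V -> R).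

Lemma cochain_add_subproof w u :
  [forall e, [ffun e => w e + dfun u e] (Defs.opp e) == - [ffun e => w e + dfun u e] e].
Proof.
apply/forallP => e; rewrite !ffunE cochain1_opp /dfun /term oppK.
by apply/eqP; ring.
Qed.

Definition cochain_add w u : cochain1 R G := Cochain1 (cochain_add_subproof w u).

Lemma cochain_addE w u e : cochain_add w u e = w e + dfun u e.
Proof. by rewrite /= ffunE. Qed.

Lemma cohomologous_add w u : cohomologous (cochain_add w u) w.
Proof.
by apply/asboolP; exists u => e; rewrite cochain_addE ffunE addrAC subrr add0r.
Qed.

Lemma closed_pairing w w' (mu : probability (tangentB R G) R) :
  closed_measure mu -> cohomologous w w' ->
  pairing w (rotation mu) = pairing w' (rotation mu).
Proof.
move=> [_ mu0] /asboolP[g ww']; apply/eqP; rewrite -subr_eq0 -(mu0 g); apply/eqP.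
rewrite /pairing /pairing_formal -sumrB; apply: eq_bigr => e _.
by rewrite -mulrBr -ww'.
Qed.

Lemma closed_homology1 (mu : probability (tangentB R G) R) :
  closed_measure mu -> homology1 (rotation mu).
Proof.
move=> [_ mu0]; apply/ffunP => x; rewrite [RHS]ffunE.
(* The indicator of [x] isolates the boundary coefficient at [x]. *)
have := mu0 (fun y => (y == x)%:R); rewrite pairing_coboundary (bigD1 x) //= eqxx mul1r.
by rewrite big1 ?addr0 // => y /negPf ->; rewrite mul0r.
Qed.

Lemma cycle_sum_eq (H : hamiltonian R G) w w' (xi : seq E) :
  cohomologous w w' -> graph_cycle xi -> \sum_(e <- xi) w e = \sum_(e <- xi) w' e.
Proof.
(* The level 0 is arbitrary: the [sigma] terms agree on both sides and cancel. *)
move=> ww' cxi; have := sigmaw_cycle H 0 ww' cxi.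
by rewrite /sigmaw_path /sigmaw !sumrB => /addrI/oppr_inj.
Qed.

End cochain_facts.

Section alpha.
Variables (R : realType) (G : graph) (H : hamiltonian R G) (c : cohomology1 R G).
Local Notation V := (vertex G).
Local Notation E := (edge G).
Local Notation T := (tangent R G).
Local Notation TB := (tangentB R G).
Implicit Types (w : cochain1 R G) (mu : probability TB R).

Lemma lagT_flux w (x : T) : lagT H x = lagwT H w x + flux w x.
Proof. by rewrite /lagwT /lagw subrK. Qed.

Lemma measurable_flux w : measurable_fun [set: TB] (flux w).
Proof.
apply/measurable_EFinP; rewrite [X in measurable_fun _ X](_ : _ = (fun x : TB =>
  \sum_e (w e)%:E * ((fun x => (fiber (x : T))%:E) \_ (half_line e)) x)%E); last first.
  by apply/funext => x /=; rewrite flux_sum.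
apply: emeasurable_sum => // e; apply: measurable_funeM.
apply/(measurable_restrictT _ (measurable_half_line e)).
by apply: measurable_funTS; apply/measurable_EFinP; exact: measurable_fiber.
Qed.

Lemma measurable_lagT : measurable_fun [set: TB] (lagT H).
Proof.
(* Any cochain serves to split [lagT H] into measurable pieces. *)
have w := repr c.
rewrite (_ : lagT H = (lagwT H w \+ flux w)); last by apply/funext => x; exact: lagT_flux.
apply: measurable_funD; [exact: measurable_lagwT|exact: measurable_flux].
Qed.

Lemma mather_alpha_ge mu : closed_measure mu ->
  ((pairing (repr c) (rotation mu))%:E - \int[mu]_x (lagT H x)%:E <= mather_alpha H c)%E.
Proof.
move=> cmu; apply: le_trans (ereal_sup_ubound _); last first.
  by exists (rotation mu) => //; exact: closed_homology1.
by rewrite leeB // ereal_inf_lbound //; exists mu.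
Qed.

Lemma lagwT_ge w b (x : T) : (forall e, H e (w e) <= b) -> - b <= lagwT H w x.
Proof.
move=> wb; elim/tangentW: x => e q; rewrite lagwT_tpoint /lagw.
by have := fenchel_young H e (w e) q%:num; have := wb e; lra.
Qed.

Lemma integral_flux_sub mu w b : finite_moment mu ->
  mu.-integrable setT (fun x => (flux w (x : T) - b)%:E) /\
  (\int[mu]_x (flux w (x : T) - b)%:E = (pairing w (rotation mu) - b)%:E)%E.
Proof.
move=> fm; have ib : mu.-integrable setT (EFin \o cst b).
  exact: finite_measure_integrable_cst.
have fw := integrable_flux w fm; split.
  under eq_fun do rewrite EFinB; exact: integrableB.
under eq_integral do rewrite EFinB.
rewrite integralB_EFin // integral_flux // (integral_cst mu measurableT). rewrite EFinB.
by rewrite [X in (_ * X)%E](_ : _ = 1%E) ?mule1 //; exact: probability_setT.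
Qed.

(** By Fenchel's inequality [flux w - b] is an integrable minorant of [lagT H]; its integral against
    a closed measure with rotation [h] is [cpairing c h - b]. *)
Lemma mather_alpha_le w b : cohomologous w (repr c) -> (forall e, H e (w e) <= b) ->
  (mather_alpha H c <= b%:E)%E.
Proof.
move=> wc wb; apply: ge_ereal_sup => _ [h h0 <-].
have -> : b%:E = ((cpairing c h)%:E - (cpairing c h - b)%:E)%E.
  by rewrite -EFinB subKr.
apply: leeB => //; apply: le_ereal_inf_tmp => _ [mu [cmu <-] <-].
rewrite /cpairing -(closed_pairing cmu wc).
have [_ <-] := integral_flux_sub w b cmu.1.
apply: measurable_le_integral.
- apply/measurable_EFinP; apply: measurable_funB => //; exact: measurable_flux.
- apply/measurable_EFinP; exact: measurable_lagT.
- move=> x; rewrite lee_fin (lagT_flux w) addrC lerD2r.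
  exact: lagwT_ge.
Qed.

(** The source of explicit lower bounds on alpha; the hypothesis on [u] is closedness of the
    discrete measure. *)
Lemma mather_alpha_discrete n (lam : nat -> {nonneg R}) (x : nat -> TB)
    (lam1 : \sum_(i < n) (lam i)%:num = 1) :
  (forall u : V -> R, \sum_(i < n) (lam i)%:num * flux (coboundary u) (x i) = 0) ->
  ((- \sum_(i < n) (lam i)%:num * lagwT H (repr c) (x i))%:E <= mather_alpha H c)%E.
Proof.
move=> x0; pose mu := (@discrete_measure R G n lam x lam1 : probability TB R).
have fm : finite_moment mu.
  rewrite /finite_moment /= integral_discrete ?ltry //; exact: measurable_fiber.
have fluxE w : pairing w (rotation mu) = \sum_(i < n) (lam i)%:num * flux w (x i).
  apply: EFin_inj; rewrite -integral_flux // integral_discrete //.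
  exact: measurable_flux.
have cmu : closed_measure mu by split=> // u; rewrite fluxE x0.
apply: le_trans (mather_alpha_ge cmu).
rewrite integral_discrete; last exact: measurable_lagT.
rewrite fluxE -EFinB lee_fin -sumrB -sumrN ler_sum // => i _.
by rewrite (lagT_flux (repr c)); lra.
Qed.

(** The test measure is at rest over [e]: it has no flux, and its action is [- H e (pmin H e)]. *)
Lemma mather_alpha_dirac e : ((H e (pmin H e))%:E <= mather_alpha H c)%E.
Proof.
have lam1 : \sum_(i < 1) (1%:nng%:num : R) = 1 by rewrite big_ord1.
apply: le_trans (@mather_alpha_discrete 1 (fun=> 1%:nng)
  (fun=> tpoint e 0%:nng) lam1 _) => [|u].
  rewrite big_ord1 /= mul1r lagwT_tpoint /lagw /= mul0r subr0 lagrangian0 opprK.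
  exact: lexx.
by rewrite big_ord1 flux_tpoint mul0r mulr0.
Qed.

Let a := fine (mather_alpha H c).

(** Finiteness: the representative itself gives a crude upper bound, a measure at rest over some
    edge a lower bound. *)
Lemma mather_alphaE : mather_alpha H c = a%:E.
Proof.
rewrite /a fineK //.
have ub : (mather_alpha H c <= (\sum_e `|H e (repr c e)|)%:E)%E.
  apply: (mather_alpha_le (cohomologous_refl (repr c))) => e.
  rewrite (bigD1 e) //=; apply: (le_trans (ler_norm _)).
  by rewrite lerDl sumr_ge0.
pose e0 : E := enum_val (Ordinal (edge_card_gt0 G)).
have lb := mather_alpha_dirac e0.
rewrite fin_numE; apply/andP; split.
- by apply/eqP => aE; rewrite aE in lb.
- by apply/eqP => aE; rewrite aE in ub.
Qed.

Lemma ham_pmin_le_alpha e : H e (pmin H e) <= a.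
Proof. by rewrite -lee_fin -mather_alphaE mather_alpha_dirac. Qed.

Lemma le_alpha w b : cohomologous w (repr c) -> (forall e, H e (w e) <= b) -> a <= b.
Proof. by move=> wc wb; rewrite -lee_fin -mather_alphaE (mather_alpha_le wc). Qed.

(* The test measure has weight proportional to 1 / q e at (e, q e): each edge of
   the cycle then carries the same flux, so the measure is closed. *)
Lemma cycle_action_ge0 (q : E -> R) (xi : seq E) : (forall e, 0 < q e) ->
  graph_cycle xi -> 0 <= \sum_(e <- xi) (lagw H (repr c) e (q e) + a) / q e.
Proof.
move=> q0 cxi; have [xi0 _] := cxi.
case: xi cxi xi0 => // e0 xi' cxi _; set xi := e0 :: xi' in cxi *.
pose S := \sum_(e <- xi) (q e)^-1.
have S0 : 0 < S.
  rewrite /S big_cons ltr_wpDr ?invr_gt0 // sumr_ge0 // => e _.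
  by rewrite invr_ge0 ltW.
have qS e : 0 <= (q e)^-1 / S by rewrite divr_ge0 ?invr_ge0 ?(ltW (q0 _)) ?(ltW S0).
pose lam e : {nonneg R} := NngNum (qS e).
pose x e : T := tpoint e (NngNum (ltW (q0 e))).
have ordE (F : E -> R) : \sum_(i < size xi) F (nth e0 xi i) = \sum_(e <- xi) F e.
  by rewrite (big_nth e0) big_mkord.
have lam1 : \sum_(i < size xi) (lam (nth e0 xi i))%:num = 1.
  by rewrite (ordE (fun e => (q e)^-1 / S)) -mulr_suml divff // gt_eqF.
have := @mather_alpha_discrete _ (fun i => lam (nth e0 xi i))
  (fun i => x (nth e0 xi i)) lam1.
rewrite (ordE (fun e => (lam e)%:num * lagwT H (repr c) (x e))).
rewrite mather_alphaE lee_fin => aL.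
have {}aL : - \sum_(e <- xi) (lam e)%:num * lagwT H (repr c) (x e) <= a.
  apply: aL => u; rewrite (ordE (fun e => (lam e)%:num * flux (coboundary u) (x e))).
  rewrite (eq_bigr (fun e => S^-1 * coboundary u e)); last first.
    move=> e _; rewrite flux_tpoint /=.
    by rewrite mulrCA !mulrA divff ?mul1r // gt_eqF.
  rewrite -mulr_sumr.
  (* An exact cochain is cohomologous to zero, so its sum around the cycle vanishes. *)
  rewrite (@cycle_sum_eq _ _ H (coboundary u) (coboundary (fun=> 0))) //.
    by rewrite big1 ?mulr0 // => e _; rewrite ffunE /dfun subrr.
  by apply/asboolP; exists u => e; rewrite [coboundary (fun=> 0) e]ffunE /dfun !subr0.
have -> : \sum_(e <- xi) (lagw H (repr c) e (q e) + a) / q e =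
    S * (\sum_(e <- xi) (lam e)%:num * lagwT H (repr c) (x e) + a).
  rewrite mulrDr mulr_sumr {2}/S mulr_suml -big_split /=; apply: eq_bigr => e _.
  rewrite lagwT_tpoint /=; field.
  by rewrite !gt_eqF.
by rewrite mulr_ge0 ?(ltW S0) //; move: aL; rewrite lerNl -subr_ge0 opprK.
Qed.

End alpha.

(** * Critical subsolutions *)

Section weak_kam.
Variables (R : realType) (G : graph) (H : hamiltonian R G) (c : cohomology1 R G).
Local Notation V := (vertex G).
Local Notation E := (edge G).
Implicit Types (w : cochain1 R G) (e : E).

Local Notation a := (fine (mather_alpha H c)).
Local Notation w0 := (repr c).

Lemma ham_between e (p p1 p2 b : R) : p1 <= p <= p2 -> H e p1 <= b -> H e p2 <= b ->
  H e p <= b.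
Proof.
case/andP; rewrite le_eqVlt => /orP[/eqP->//|p1p].
rewrite le_eqVlt => /orP[/eqP->//|pp2] H1 H2.
pose t := (p2 - p) / (p2 - p1).
have d0 : 0 < p2 - p1 by lra.
have t01 : 0 <= t <= 1.
  apply/andP; split; first by rewrite divr_ge0 //; lra.
  by rewrite ler_pdivrMr //; lra.
have := ham_convex H e p1 p2 t01.
have -> : t * p1 + (1 - t) * p2 = p by rewrite /t; field; lra.
by case/andP: t01; nra.
Qed.

(* This infimum is sigma^w(e, a), but the argument only uses the inequality
   [ham_edge_cost] and so never inverts H. *)
Definition edge_cost e : R :=
  inf [set (lagw H w0 e q + a) / q | q in [set q | 0 < q]].

Lemma edge_cost_has_inf e :
  has_inf [set (lagw H w0 e q + a) / q | q in [set q | 0 < q]].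
Proof.
split; first by exists ((lagw H w0 e 1 + a) / 1), 1 => //=; exact: ltr01.
exists (pmin H e - w0 e) => _ [q /= q0 <-].
rewrite ler_pdivlMr // /lagw.
have := fenchel_young H e (pmin H e) q; have := ham_pmin_le_alpha H c e; lra.
Qed.

Lemma edge_cost_le e (q : R) : 0 < q -> edge_cost e <= (lagw H w0 e q + a) / q.
Proof. by move=> q0; apply: inf_lbound; [case: (edge_cost_has_inf e)|exists q]. Qed.

Lemma edge_cost_ge e : pmin H e - w0 e <= edge_cost e.
Proof.
apply: lb_le_inf; first by case: (edge_cost_has_inf e).
move=> _ [q /= q0 <-]; rewrite ler_pdivlMr // /lagw.
have := fenchel_young H e (pmin H e) q; have := ham_pmin_le_alpha H c e; lra.
Qed.

(** Let [q] be the derivative of [H e] at the shifted cost [P]. If [q > 0], it competes in the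
    infimum with value [edge_cost e + (a - H e P) / q], so [H e P <= a]. If [q = 0], [P] realizes
    the minimum of [H e]. *)
Lemma ham_edge_cost e : H e (edge_cost e + w0 e) <= a.
Proof.
have := edge_cost_ge e; set P := (X in H e X).
rewrite lerBlDr -/P le_eqVlt => /orP[/eqP<-|pP]; first exact: ham_pmin_le_alpha.
have := lagrangian_derive H e P; have := derive_pmin_ge0 pP.
rewrite le_eqVlt => /orP[/eqP<-|].
  by rewrite lagrangian0; have := ham_pmin_le_alpha H c e; lra.
move: (derive1 _ _) => q q0 LP; have := edge_cost_le e q0.
by rewrite ler_pdivlMr // /lagw LP /P; lra.
Qed.

(** The infima may fail to be attained, so near-optimal speeds are fed to [cycle_action_ge0]. *)
Lemma cycle_cost_ge0 (xi : seq E) : graph_cycle xi ->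
  0 <= \sum_(e <- xi) edge_cost e.
Proof.
move=> cxi; rewrite leNgt; apply/negP => cost0.
have n0 : 0 < (size xi)%:R :> R.
  by case: cxi => + _; case: xi cost0 => //= *; rewrite ltr0n.
(* With this [eps] the errors along the cycle add up to half of the supposed deficit. *)
pose eps := - (\sum_(e <- xi) edge_cost e) / (2 * (size xi)%:R).
have eps0 : 0 < eps by rewrite divr_gt0 ?oppr_gt0 ?mulr_gt0.
have qP e : exists q, 0 < q /\ (lagw H w0 e q + a) / q < edge_cost e + eps.
  by have [_ [q q0 <-] ?] := inf_adherent eps0 (edge_cost_has_inf e); exists q.
pose q e := xget 0 [set q | 0 < q /\ (lagw H w0 e q + a) / q < edge_cost e + eps].
have qE e : 0 < q e /\ (lagw H w0 e (q e) + a) / q e < edge_cost e + eps.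
  exact: (xgetPex 0 (qP e)).
have := @cycle_action_ge0 _ _ H c q xi (fun e => (qE e).1) cxi.
have : \sum_(e <- xi) (lagw H w0 e (q e) + a) / q e <= \sum_(e <- xi) (edge_cost e + eps).
  by apply: ler_sum => e _; exact/ltW/(qE e).2.
rewrite big_split /= big_const_seq count_predT iter_addr_0 -mulr_natr.
have -> : eps * (size xi)%:R = - (\sum_(e <- xi) edge_cost e) / 2.
  by rewrite /eps; field; rewrite gt_eqF.
by lra.
Qed.

(** Empty walks are excluded, as in [linked], so a walk followed by a return walk is a
    [graph_cycle]. *)
Definition walk (x y : V) (s : seq E) : Prop :=
  match s with
  | [::] => False
  | e :: s' => [/\ path (@next_edge G) e s', orig e = x & term (last e s') = y]
  end.

Lemma walk_cycle x y s s' : walk x y s -> walk y x s' -> graph_cycle (s ++ s').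
Proof.
case: s => // e s [es ex ey]; case: s' => // f s' [fs fy fx]; split=> //=.
rewrite rcons_cat /= cat_path es /= {1}/next_edge /= ey fy eqxx /= rcons_path fs /=.
by rewrite /next_edge /= fx ex.
Qed.

Lemma walk_rcons x s e : walk x (orig e) s -> walk x (term e) (rcons s e).
Proof.
case: s => // f s [fs fx fe]; split=> //=; last by rewrite last_rcons.
by rewrite rcons_path fs /= /next_edge /= fe.
Qed.

Hypothesis Gconn : graph_connected G.

Lemma walk_ex x y : exists s, walk x y s.
Proof. by have [e [s es]] := Gconn x y; exists (e :: s). Qed.

Definition potential (x y : V) : R :=
  inf [set \sum_(e <- s) edge_cost e | s in walk x y].

Lemma potential_le x e : potential x (term e) <= potential x (orig e) + edge_cost e.
Proof.
have hasi y : has_inf [set \sum_(e <- s) edge_cost e | s in walk x y].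
  split; first by have [s xs] := walk_ex x y; exists (\sum_(e <- s) edge_cost e), s.
  (* A fixed return walk closes every walk into a cycle of nonnegative cost, which bounds the costs
     from below. *)
  have [r yr] := walk_ex y x; exists (- \sum_(e <- r) edge_cost e) => _ [s xs <-].
  by have := cycle_cost_ge0 (walk_cycle xs yr); rewrite big_cat /=; lra.
rewrite -lerBlDr; apply: lb_le_inf; first by case: (hasi (orig e)).
move=> _ [s xs <-]; rewrite lerBlDr; apply: inf_lbound; first by case: (hasi (term e)).
by exists (rcons s e); [exact: walk_rcons|rewrite big_rcons /= addrC].
Qed.

(** Applied to [e] and its opposite, [potential_le] traps [w e] between two momenta where [H e] is
    at most [a]; sublevel sets are convex. *)
Lemma critical_cochain : exists2 w, cohomologous w w0 & forall e, H e (w e) <= a.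
Proof.
pose x : V := orig (enum_val (Ordinal (edge_card_gt0 G))).
exists (cochain_add w0 (potential x)); first exact: cohomologous_add.
move=> e; rewrite cochain_addE /dfun.
have ue := potential_le x e; have uoe := potential_le x (Defs.opp e).
rewrite /term oppK -/(term e) in uoe.
apply: (@ham_between e _ (- (edge_cost (Defs.opp e) + w0 (Defs.opp e)))
  (edge_cost e + w0 e)).
- by rewrite cochain1_opp; apply/andP; split; lra.
- by rewrite ham_opp opprK ham_edge_cost.
- exact: ham_edge_cost.
Qed.

(** Trades subsolutions for cochains of the same class, the form in which the bounds on alpha
    apply. *)
Lemma subsolutionP w (b : R) u : subsolution H w b u <->
  forall e, H e (cochain_add w u e) <= b.
Proof.
split=> [su e|su x e _]; last by rewrite /hamw addrC -cochain_addE.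
by have := su _ e erefl; rewrite /hamw addrC -cochain_addE.
Qed.

Lemma critical_subsolution : exists u, subsolution H w0 a u.
Proof.
have [w /asboolP[u wu] wa] := critical_cochain.
exists u; apply/subsolutionP => e; have := wu e; rewrite cochain_addE ffunE => <-.
by rewrite addrC subrK.
Qed.

Lemma critical_valueE : critical_value H c = a.
Proof.
apply/eqP; rewrite eq_le; apply/andP; split.
- apply: inf_lbound; last exact: critical_subsolution.
  exists a => b [u /subsolutionP ub]; exact: le_alpha (cohomologous_add w0 u) ub.
- apply: lb_le_inf; first by exists a; exact: critical_subsolution.
  move=> b [u /subsolutionP ub]; exact: le_alpha (cohomologous_add w0 u) ub.
Qed.

End weak_kam.

(** * Supports of minimizing measures *)

Section mather_support.
Variables (R : realType) (G : graph) (H : hamiltonian R G) (c : cohomology1 R G).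
Local Notation V := (vertex G).
Local Notation E := (edge G).
Local Notation T := (tangent R G).
Local Notation TB := (tangentB R G).
Local Notation a := (fine (mather_alpha H c)).
Variable w : cochain1 R G.
Hypotheses (wc : cohomologous w (repr c)) (wa : forall e, H e (w e) <= a).
Variable mu : probability TB R.
Hypothesis mu_min : minimizing_measure H c mu.

Let closed_mu : closed_measure mu := mu_min.1.

Lemma integrable_lagwT_minimizing :
  mu.-integrable setT (fun x => (lagwT H (repr c) (x : T))%:E).
Proof.
have mL := measurable_lagwT H (repr c).
apply/integrableP; split; first exact/measurable_EFinP.
by rewrite integral_fin_num_abs // mu_min.2 mather_alphaE.
Qed.

(** Minimality is stated for [repr c], the pointwise bound for [w]; the two actions differ by fluxes
    of cohomologous cochains, which agree on closed measures. *)
Lemma integral_gap : (\int[mu]_x (lagwT H w (x : T) + a)%:E = 0)%E.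
Proof.
have fm := closed_mu.1.
have [i1 e1] := integral_flux_sub w a fm.
have i2 := integrable_flux (repr c) fm; have e2 := integral_flux (repr c) fm.
have i3 := integrable_lagwT_minimizing.
have -> : (fun x : TB => (lagwT H w (x : T) + a)%:E) =
  (fun x : TB => ((lagwT H (repr c) x + flux (repr c) x)%:E - (flux w x - a)%:E)%E).
  apply/funext => x; rewrite -EFinB -lagT_flux (lagT_flux _ w); congr EFin; lra.
have i4 : mu.-integrable setT (fun x => (lagwT H (repr c) (x : T) + flux (repr c) x)%:E).
  by under eq_fun do rewrite EFinD; exact: integrableD.
rewrite integralB_EFin // e1 integralD_EFin // e2 mu_min.2 mather_alphaE.
rewrite (closed_pairing closed_mu wc) -!EFinN -!EFinD; congr EFin; lra.
Qed.

Lemma gap_null : mu [set x | - a < lagwT H w x] = 0%E.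
Proof.
have mF : measurable_fun setT (fun x : TB => (lagwT H w (x : T) + a)%:E).
  by apply/measurable_EFinP; apply: measurable_funD => //; exact: measurable_lagwT.
have : (\int[mu]_x `|(lagwT H w (x : T) + a)%:E| = 0)%E.
  rewrite -[RHS]integral_gap; apply: eq_integral => x _.
  rewrite gee0_abs // lee_fin -lerBlDr sub0r; exact: lagwT_ge.
move/(ae_eq_integral_abs _ measurableT mF) => F0.
apply: (measure_negligible (open_measurable (@open_lagwT_gt _ _ H w (- a)))).
apply: (negligibleS _ F0) => x /= ax /(_ I) []; move: ax; lra.
Qed.

Lemma support_lagwT x : msupport mu x -> lagwT H w x = - a.
Proof.
move=> sx; apply/eqP; rewrite eq_le lagwT_ge // andbT leNgt; apply/negP => ax.
have := sx [set x | - a < lagwT H w x] (conj (@open_lagwT_gt _ _ H w (- a)) ax).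
by rewrite gap_null ltxx.
Qed.

(** The coefficient of [e] in the formal sum behind [rotation], before [e] and its opposite are
    identified; hence it is nonnegative. *)
Definition mass e : R := fine (\int[mu]_(x in half_line e) (fiber (x : T))%:E)%E.

Lemma mass_ge0 e : 0 <= mass e.
Proof. by apply/fine_ge0/integral_ge0 => x _; rewrite lee_fin fiber_ge0. Qed.

Lemma mass_conservation (g : V -> R) : \sum_e mass e * dfun g e = 0.
Proof.
rewrite -[RHS](closed_mu.2 g) /rotation pairing_pi /pairing_formal.
by apply: eq_bigr => e _; rewrite !ffunE.
Qed.

Lemma mass_eq0P e : mass e = 0 <->
  mu [set x : T | half_line e x /\ 0 < fiber x] = 0%E.
Proof.
have mh := @measurable_half_line R G e.
have mf : measurable_fun (half_line e : set TB) (fun x : TB => (fiber (x : T))%:E).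
  by apply: measurable_funTS; apply/measurable_EFinP; exact: measurable_fiber.
have := ae_eq_integral_abs mu mh mf.
rewrite (eq_integral (fun x : TB => (fiber (x : T))%:E)); last first.
  by move=> x _; rewrite gee0_abs // lee_fin fiber_ge0.
have intE : (\int[mu]_(x in half_line e) (fiber (x : T))%:E = (mass e)%:E)%E.
  rewrite fineK // integrable_fin_num //.
  by apply: integrableS (integrable_fiber closed_mu.1).
rewrite intE => massP; split=> [m0|mu0].
- move: massP; rewrite m0 => -[/(_ erefl) ae0 _].
  apply: (measure_negligible (open_measurable (@open_half_line_pos R G e))).
  apply: negligibleS ae0 => x /= [ex x0] /(_ ex) []; move: x0; lra.
- apply: EFin_inj; apply/massP.
  exists [set x : T | half_line e x /\ 0 < fiber x]; split=> //.
    exact: open_measurable (@open_half_line_pos R G e).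
  move=> x /= /not_implyP[ex x0]; split=> //.
  by rewrite lt_neqAle fiber_ge0 andbT; apply/negP => /eqP x0'; apply: x0; rewrite -x0'.
Qed.

Lemma support_mass e (q : {nonneg R}) : msupport mu (tpoint e q) -> 0 < q%:num ->
  0 < mass e.
Proof.
move=> se q0; rewrite lt_neqAle mass_ge0 andbT eq_sym; apply/negP => /eqP/mass_eq0P mu0.
have /se : open_nbhs (tpoint e q) [set x : T | half_line e x /\ 0 < fiber x].
  by split; [exact: open_half_line_pos|split; [exists q|rewrite fiber_tpoint]].
by rewrite mu0 ltxx.
Qed.

(** Otherwise the points of positive height over [e] would lie in the null set of [gap_null], and
    [e] would have no mass. *)
Lemma mass_calibrated e : 0 < mass e ->
  exists2 q : {nonneg R}, 0 < q%:num & lagwT H w (tpoint e q) = - a.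
Proof.
move=> e0; apply: contrapT => noq.
suff : mass e = 0 by move=> e0'; rewrite e0' ltxx in e0.
apply/mass_eq0P/eqP; rewrite -measure_le0 -gap_null le_measure ?inE //.
- exact: open_measurable (@open_half_line_pos R G e).
- exact: open_measurable (@open_lagwT_gt _ _ H w (- a)).
move=> _ [[q _ <-]]; rewrite fiber_tpoint => q0 /=.
rewrite lt_neqAle lagwT_ge // andbT; apply/negP => /eqP aq; apply: noq.
by exists q.
Qed.

End mather_support.

(** * Calibrated edges and the Aubry set *)

(** If no walk along positive edges leads from [e] back to [orig e], the set of vertices it reaches
    is entered by [e] and never left by positive flux, against conservation. *)
Lemma circulation_cycle (R : realType) (G : graph) (z : edge G -> R) (e : edge G) :
  (forall e, 0 <= z e) -> (forall g : vertex G -> R, \sum_e z e * dfun g e = 0) ->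
  0 < z e -> exists xi, [/\ graph_cycle xi, e \in xi & {in xi, forall f, 0 < z f}].
Proof.
move=> z0 zg ze.
pose reach v := exists s, [/\ path (@next_edge G) e s,
  {in s, forall f, 0 < z f} & term (last e s) = v].
have reachS f : 0 < z f -> reach (orig f) -> reach (term f).
  move=> zf [s [es sz sf]]; exists (rcons s f); split.
  - by rewrite rcons_path es /next_edge /= sf.
  - by move=> g; rewrite mem_rcons inE => /predU1P[->|/sz].
  - by rewrite last_rcons.
have [[s [es sz se]]|noreach] := pselect (reach (orig e)).
  exists (e :: s); split; last by move=> f /[!inE] /predU1P[->|/sz].
  - by split=> //=; rewrite rcons_path es /next_edge /= se.
  - exact: mem_head.
have reache : reach (term e) by exists [::].
(* This indicator does not decrease along positive edges and jumps by 1 along [e]. *)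
pose g v : R := `[<reach v>]%:R.
have ge0 f : 0 <= z f * dfun g f.
  move: (z0 f); rewrite le_eqVlt => /orP[/eqP<-|zf]; first by rewrite mul0r.
  rewrite mulr_ge0 ?(ltW zf) // /dfun /g subr_ge0 ler_nat.
  by case: asboolP => [/(reachS _ zf)/asboolP->|].
have := zg g; rewrite (bigD1 e) //= => sum0.
have : 0 <= \sum_(f | f != e) z f * dfun g f by exact: sumr_ge0.
have : z e * dfun g e = z e.
  by rewrite /dfun /g (asboolT reache) (asboolF noreach) subr0 mulr1.
by lra.
Qed.

Section calibrated.
Variables (R : realType) (G : graph) (H : hamiltonian R G) (c : cohomology1 R G).
Hypothesis Gconn : graph_connected G.
Local Notation a := (fine (mather_alpha H c)).
Variable w : cochain1 R G.
Hypotheses (wc : cohomologous w (repr c)) (wa : forall e, H e (w e) <= a).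
Implicit Types (e : edge G) (q : {nonneg R}).

(** Since [H e (w e) <= a], the hypothesis forces [H e (w e) = a] and equality in Fenchel's
    inequality at momentum [w e]. *)
Lemma calibrated_speed e q : lagwT H w (tpoint e q) = - a ->
  derive1 (H e) (w e) = q%:num /\ sigma H e a = w e.
Proof.
rewrite lagwT_tpoint /lagw => Lq.
have Ha : H e (w e) = a.
  apply/eqP; rewrite eq_le wa /=.
  by have := fenchel_young H e (w e) q%:num; lra.
have [||pw ->] := @fenchel_young_eq _ _ H e (w e) q%:num; first by [].
  by rewrite Ha; lra.
by split=> //; rewrite -Ha sigma_ham.
Qed.

Lemma aubry_calibrated (xi : seq (edge G)) e : graph_cycle xi -> e \in xi ->
  {in xi, forall f, exists q, lagwT H w (tpoint f q) = - a} -> aubry_set H c e.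
Proof.
move=> cxi exi xicalib; exists xi; split=> //.
(* Each term vanishes for [w]; [sigmaw_cycle] carries the sum over to the representative in
   [aubry_set]. *)
rewrite critical_valueE // -(sigmaw_cycle H a wc cxi) /sigmaw_path big_seq big1 // => f.
by move=> /xicalib[q /calibrated_speed[_ sf]]; rewrite /sigmaw sf subrr.
Qed.

Lemma support_aubry (mu : probability (tangentB R G) R) e q :
  minimizing_measure H c mu -> msupport mu (tpoint e q) -> aubry_set H c e.
Proof.
move=> mu_min se; have q0 : 0 <= q%:num by [].
move: q0; rewrite le_eqVlt => /orP[/eqP q0|q0].
  (* At height 0 the point lies over both [e] and its opposite and calibrates both. *)
  apply: (@aubry_calibrated [:: e; Defs.opp e]); last first.
  - move=> f; rewrite !inE => /orP[]/eqP->; exists q; last rewrite tpoint0 //;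
      exact: (support_lagwT wc wa mu_min).
  - exact: mem_head.
  - by split=> //=; rewrite /next_edge /= /term oppK !eqxx.
have [xi [cxi exi xiz]] := circulation_cycle (mass_ge0 mu) (mass_conservation mu_min)
  (support_mass mu_min se q0).
apply: aubry_calibrated exi _ => // f /xiz fz.
by have [r _ fr] := mass_calibrated wc wa mu_min fz; exists r.
Qed.

End calibrated.

Theorem theorem8p5 (R : realType) (G : graph) (Gconn : graph_connected G)
    (Gloopless : graph_loopless G) (H : hamiltonian R G)
    (c : cohomology1 R G) :
  [/\ projected_mather_set H c `<=` aubry_set H c,
      forall e, projected_mather_set H c e -> 0 <= Qspeed H c e &
      mather_set H c =
        [set x | exists2 e, projected_mather_set H c e &
           exists2 q : {nonneg R}, q%:num = Qspeed H c e & x = tpoint e q]].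
Proof.
have cE := critical_valueE H c Gconn.
have [w wc wa] := critical_cochain H c Gconn.
have QE e q : mather_set H c (tpoint e q) -> Qspeed H c e = q%:num.
  move=> [mu mu_min se].
  (* [Qspeed] is a [get], so both existence and uniqueness are required. Any admissible pair yields
     the critical cochain [cochain_add w' u], for which the support point is calibrated as well. *)
  have Q_unique (w' : cochain1 R G) u : \pi_(cohomology1 R G) w' = c ->
      subsolution H w' (critical_value H c) u ->
      derive1 (hamw H w' e) (dfun u e) = q%:num.
    move=> w'c; rewrite cE => /subsolutionP w'a.
    have w'uc : cohomologous (cochain_add w' u) (repr c).
      apply: (cohomologous_trans (cohomologous_add w' u)).
      by rewrite cohomologous_sym -w'c cohomologous_pi.
    have [<- _] := calibrated_speed w'a (support_lagwT w'uc w'a mu_min se).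
    rewrite cochain_addE /derive1 addrC /hamw.
    by under eq_fun do rewrite -addrA.
  have Qex : [set r | exists w' u, [/\ \pi_(cohomology1 R G) w' = c,
      subsolution H w' (critical_value H c) u &
      r = derive1 (hamw H w' e) (dfun u e)]] !=set0.
    have [u us] := critical_subsolution H c Gconn.
    exists (derive1 (hamw H (repr c) e) (dfun u e)), (repr c), u.
    by split=> //; [exact: reprK|rewrite cE].
  by have [w' [u [w'c w'u]]] := getPex Qex; rewrite /Qspeed => ->; exact: Q_unique.
have projE e : projected_mather_set H c e <-> exists q, mather_set H c (tpoint e q).
  split=> [[x xM /piEP[q xE]]|[q qM]]; first by exists q; rewrite -xE.
  by exists (tpoint e q) => //; apply/piEP; exists q.
split.
- by move=> e /projE[q [mu mu_min se]]; exact: (support_aubry Gconn wc wa mu_min se).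
- by move=> e /projE[q /QE ->].
- apply/seteqP; split.
  + elim/tangentW => e q eM; exists e; first by apply/projE; exists q.
    by exists q => //; rewrite (QE _ _ eM).
  + move=> _ [e /projE[q' eM] [q qE ->]].
    (* The height over [e] is fixed by [Qspeed], so the given point is the one already in the Mather
       set. *)
    suff -> : q = q' by [].
    by apply/val_inj; rewrite /= qE (QE _ _ eM).
Qed.
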